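(* Let $G=(V,E)$ be a finite graph, and for each $v\in V$ let $\mathsf P_v\subseteq\mathbb Z$ be an arbitrary set. Let $\mathcal N\big(G;\prod_{v\in V}\mathsf P_v\big)$ denote the total number of orientations of $G$ in which the out-degree of each vertex $v$ belongs to $\mathsf P_v$. Then $$ \mathcal N\Big(G;\prod_{v\in V}\mathsf P_v\Big)=\sum_{F\subseteq E}\frac{(-1)^{|F|}}{2^{|E|}}\prod_{v\in V}\mathcal C\Big((1-z)^{d_F(v)}(1+z)^{d_v-d_F(v)}\,;\,\mathsf P_v\Big), $$ where $d_v$ is the degree of $v$ in $G$ and $d_F(v)$ is the degree of $v$ in the subgraph $(V,F)$.
   Context: An orientation of a graph $G=(V,E)$ is an assignment of a direction to each edge $\{u,v\}\in E$. For $\mathsf P\subseteq\mathbb Z$ and a polynomial $q(z)$, $\mathcal C(q(z);\mathsf P)$ denotes the sum, over all integers $\ell\ge 0$ with $\ell\in\mathsf P$, of the coefficient of $z^\ell$ in $q(z)$. *)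

(* Defs.v *)
From HB Require Import structures.
From mathcomp Require Import all_boot all_order all_algebra.
From mathcomp Require Import boolp classical_sets.
Set Implicit Arguments.
Unset Strict Implicit.
Unset Printing Implicit Defensive.
Import Order.TTheory GRing.Theory Num.Theory.
Local Open Scope ring_scope.

Definition simple_graph (V : finType) (E : {set {set V}}) : Prop :=
  forall e : {set V}, e \in E -> #|e| = 2%N.

Definition degree (V : finType) (F : {set {set V}}) (v : V) : nat :=
  #|[set e in F | v \in e]|.

Definition edge (V : finType) (E : {set {set V}}) : finType :=
  {e : {set V} | e \in E}.

(* The pair (u, w) assigned to an edge {u, w} is the arc u -> w. *)
Definition is_orientation (V : finType) (E : {set {set V}})
    (o : {ffun edge E -> V * V}) : bool :=
  [forall e : edge E, sval e == [set (o e).1; (o e).2]%SET].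

Definition outdegree (V : finType) (E : {set {set V}})
    (o : {ffun edge E -> V * V}) (v : V) : nat :=
  #|[set e : edge E | (o e).1 == v]|.

Definition num_orientations (V : finType) (E : {set {set V}})
    (P : V -> set int) : nat :=
  #|[set o : {ffun edge E -> V * V} |
      is_orientation o && [forall v : V, `[< P v (outdegree o v)%:Z >]]]|.

(* Coefficients of index at least [size q] vanish, so this finite sum ranges
   over all l >= 0 in P. *)
Definition coefs_in (R : nzRingType) (q : {poly R}) (P : set int) : R :=
  \sum_(l < size q | `[< P (l : nat)%:Z >]) q`_l.

(* Main.v *)
Require Import Defs.
From HB Require Import structures.
From mathcomp Require Import all_boot all_order all_algebra.
From mathcomp Require Import boolp classical_sets.
Set Implicit Arguments.
Unset Strict Implicit.
Unset Printing Implicit Defensive.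
Import Order.TTheory GRing.Theory Num.Theory.
Local Open Scope ring_scope.

(** Cut every edge into its two half-edges and let each vertex v choose freely
    a set x v of edges at v, the edges it wants to leave through.  Such a
    choice x is an orientation exactly when each edge is chosen by one of its
    two ends, i.e. by an odd number of them ([out_stars_inj],
    [out_stars_onto]).  The indicator of that condition is a product over the
    edges of (1 - s_e) / 2, where s_e is the product over the ends of e of the
    signs recording whether e is chosen there; expanding the product gives the
    sum over F of (-1)^|F| / 2^|E| times a product of signs over the
    half-edges of F ([prod_odd_indicator]).

    After this expansion nothing ties different vertices together any more:
    for a fixed F the sum over all x of the product of signs and of the
    out-degree constraints factors over the vertices.  The factor at v is a
    signed count of the sets S of edges at v with |S| in P_v, the sign being
    (-1)^|F :&: S|, and the generating function of these signed counts is
    (1 - z)^(d_F(v)) (1 + z)^(d_v - d_F(v)) ([coefs_inE]). *)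

Lemma prodr_1D (R : comNzRingType) (I : finType) (A : {set I}) (a : I -> R) :
  \prod_(i in A) (1 + a i) =
  \sum_(J : {set I} | J \subset A) \prod_(i in J) a i.
Proof.
(* Setting a to 0 outside A makes the product range over the whole type and
   kills the subsets J that are not contained in A. *)
pose b i := if i \in A then a i else 0.
transitivity (\prod_i (b i + 1)).
  rewrite big_mkcond; apply: eq_bigr => i _; rewrite /b addrC.
  by case: ifP; rewrite ?add0r.
rewrite bigA_distr [RHS]big_mkcond; apply: eq_bigr => J _; rewrite -big_mkcond.
case: ifPn => [sJA | /subsetPn[i iJ iA]].
  by apply: eq_bigr => i iJ; rewrite /b (fintype.subsetP sJA).
by rewrite (bigD1 i) //= /b (negPf iA) mul0r.
Qed.

Lemma prodr_sign_in (R : comNzRingType) (T : finType) (B S : {set T}) :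
  \prod_(i in S) (-1) ^+ (i \in B) = (-1) ^+ #|B :&: S| :> R.
Proof.
rewrite prodrXr; congr (_ ^+ _).
rewrite -sum1_card [RHS]big_mkcond [LHS]big_mkcond /=.
by apply: eq_bigr => i _; rewrite inE; do 2 case: (i \in _).
Qed.

Lemma coefs_in_widen (R : nzRingType) (q : {poly R}) (P : set int) n :
  (size q <= n)%N ->
  coefs_in q P = \sum_(l < n | `[< P (l : nat)%:Z >]) q`_l.
Proof.
move=> le_qn; rewrite /coefs_in.
rewrite (big_ord_widen_cond _ (fun l : nat => `[< P l%:Z >]) _ le_qn).
rewrite big_mkcondr; apply: eq_bigr => l _; case: ltnP => // le_ql.
by rewrite nth_default.
Qed.

(** The polynomial is the product over i in A of 1 + z or 1 - z, with the minus
    sign for i in B; choosing a term in each factor amounts to choosing a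
    subset S of A, which contributes (-1)^|B :&: S| z^|S|. *)
Lemma coefs_inE (R : comNzRingType) (T : finType) (A B : {set T})
    (P : set int) :
  B \subset A ->
  coefs_in ((1 - 'X) ^+ #|B| * (1 + 'X) ^+ (#|A| - #|B|)%N : {poly R}) P =
  \sum_(S : {set T} | S \subset A)
    `[< P #|S|%:Z >]%:R * (-1) ^+ #|B :&: S|.
Proof.
move=> sBA.
have -> : (1 - 'X) ^+ #|B| * (1 + 'X) ^+ (#|A| - #|B|)%N =
    \sum_(S : {set T} | S \subset A) (-1) ^+ #|B :&: S| *: 'X^#|S| :> {poly R}.
  transitivity (\prod_(i in A) (1 + (-1) ^+ (i \in B) *: 'X : {poly R})).
    rewrite (big_setID B) /= (finset.setIidPr sBA) -(cardsDS sBA) -!prodr_const.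
    congr (_ * _); apply: eq_bigr => i.
      by move=> ->; rewrite expr1 scaleN1r.
    by rewrite inE => /andP[/negPf-> _]; rewrite expr0 scale1r.
  rewrite prodr_1D; apply: eq_bigr => S _.
  by rewrite scaler_prod prodr_sign_in prodr_const.
rewrite (@coefs_in_widen _ _ _ #|A|.+1); last first.
  apply: (leq_trans (size_sum _ _ _)); apply/bigmax_leqP => S sSA.
  apply: (leq_trans (size_scale_leq _ _)).
  by rewrite size_polyXn ltnS subset_leq_card.
under eq_bigr => l _ do rewrite coef_sum.
rewrite exchange_big; apply: eq_bigr => S sSA /=.
have ltSA : (#|S| < #|A|.+1)%N by rewrite ltnS subset_leq_card.
rewrite big_mkcond (bigD1 (Ordinal ltSA)) //= big1 ?addr0 => [|l nl].
  by rewrite coefZ coefXn eqxx mulr1; case: `[< _ >]; rewrite ?mul1r ?mul0r.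
rewrite coefZ coefXn -(inj_eq val_inj) /= in nl *.
by rewrite (negPf nl) mulr0 if_same.
Qed.

Definition star (V : finType) (E : {set {set V}}) (v : V) : {set {set V}} :=
  [set e in E | v \in e].

Definition tails (V : finType) (x : {ffun V -> {set {set V}}}) (e : {set V}) :
  {set V} := [set v | e \in x v].

(** The half-edge encoding of an orientation: at each vertex, the edges that
    leave it. *)
Definition out_stars (V : finType) (E : {set {set V}})
    (o : {ffun edge E -> V * V}) : {ffun V -> {set {set V}}} :=
  [ffun v => val @: [set e | (o e).1 == v]].

(** For edges with two ends, an odd number of tails means exactly one tail.
    Parity is the right form of the condition because its indicator is affine
    in the sign (-1)^#|tails x e|, which is multiplicative over the ends. *)
Definition one_tailed (V : finType) (E : {set {set V}})
    (x : {ffun V -> {set {set V}}}) : bool :=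
  (x \in family (fun v => [pred S : {set {set V}} | S \subset star E v])) &&
  [forall e in E, odd #|tails x e|].

Lemma card_out_stars (V : finType) (E : {set {set V}})
    (o : {ffun edge E -> V * V}) v : #|out_stars o v| = outdegree o v.
Proof. by rewrite ffunE card_imset //; apply: val_inj. Qed.

Lemma mem_out_stars (V : finType) (E : {set {set V}})
    (o : {ffun edge E -> V * V}) (e : edge E) v :
  (val e \in out_stars o v) = ((o e).1 == v).
Proof. by rewrite ffunE mem_imset ?inE //; apply: val_inj. Qed.

Lemma tails_out_stars (V : finType) (E : {set {set V}})
    (o : {ffun edge E -> V * V}) (e : edge E) :
  tails (out_stars o) (val e) = [set (o e).1]%SET.
Proof. by apply/setP => v; rewrite !inE mem_out_stars eq_sym. Qed.

(** The leaving edges determine the tail of each edge, and the head is then the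
    remaining end, as the two ends differ. *)
Lemma out_stars_inj (V : finType) (E : {set {set V}}) :
  simple_graph E ->
  {in [pred o | is_orientation o] &, injective (@out_stars V E)}.
Proof.
move=> hE o o'; rewrite !inE => /forallP or_o /forallP or_o' eq_oo'.
apply/ffunP => e; have /setP tl: [set (o e).1]%SET = [set (o' e).1]%SET.
  by rewrite -!tails_out_stars eq_oo'.
have eq1 : (o e).1 = (o' e).1.
  by apply/set1P; rewrite -tl set11.
move: (eqP (or_o e)) (eqP (or_o' e)) eq1 (hE _ (valP e)).
case: (o e) (o' e) => [u w] [u' w'] /= -> eq_e eqw; subst u'.
rewrite cards2; case: eqP => // /eqP neq_uw _; congr (_, _).
have: w \in [set u; w']%SET by rewrite -eq_e set22.
by rewrite !inE eq_sym (negPf neq_uw) => /eqP.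
Qed.

(** In a two-element edge an odd set of tails is a singleton, and so is its
    complement: these are the tail and the head of the arc to be assigned to
    the edge. *)
Lemma out_stars_onto (V : finType) (E : {set {set V}}) :
  simple_graph E ->
  (@out_stars V E) @: [set o | is_orientation o] = [set x | one_tailed E x]%SET.
Proof.
move=> hE; apply/setP => x; rewrite inE; apply/imsetP/andP.
  move=> [o]; rewrite inE => /forallP or_o ->; split.
    apply/familyP => v; rewrite inE; apply/fintype.subsetP => e.
    rewrite ffunE => /imsetP[e']; rewrite !inE => /eqP<- ->.
    by rewrite (valP e') -[val e']/(sval e') (eqP (or_o e')) set21.
  apply/forall_inP => e eE.
  by rewrite (tails_out_stars o (exist _ e eE)) cards1.
move=> [/familyP sub_x /forall_inP odd_x].
have x_star v e : e \in x v -> (e \in E) && (v \in e).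
  by move: (sub_x v); rewrite inE => /fintype.subsetP/[apply]; rewrite inE.
have /fin_all_exists[o or_o] (e : edge E) : exists p : V * V,
    sval e = [set p.1; p.2]%SET /\ tails x (sval e) = [set p.1]%SET.
  have := odd_x _ (valP e); set t := tails x _ => odd_t.
  have st : t \subset sval e.
    by apply/fintype.subsetP => v; rewrite inE => /x_star/andP[].
  have t1 : #|t| = 1%N.
    have := subset_leq_card st; rewrite (hE _ (valP e)).
    by case: #|t| odd_t => [|[|[]]].
  have /eqP/cards1P[u tu] := t1.
  have : #|sval e :\: t| == 1%N by rewrite cardsDS // t1 (hE _ (valP e)).
  case/cards1P => w ew; exists (u, w); split=> //=.
  by rewrite -(finset.setID (sval e) t) (finset.setIidPr st) ew tu.
exists [ffun e => o e].
  by rewrite inE; apply/forallP => e; rewrite ffunE; have [->] := or_o e.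
apply/ffunP => v; apply/setP => e.
have [eE | eE] := boolP (e \in E); last first.
  rewrite [LHS](contraNF _ eE); last by case/x_star/andP.
  by rewrite ffunE; apply/esym/imsetP => -[e' _ ee']; rewrite ee' (valP e') in eE.
rewrite (mem_out_stars _ (exist _ e eE)) ffunE.
have [_ /setP/(_ v)] := or_o (exist _ e eE).
by rewrite !inE /= eq_sym.
Qed.

Lemma num_orientations_one_tailed (V : finType) (E : {set {set V}})
    (P : V -> set int) :
  simple_graph E ->
  num_orientations E P =
  #|[set x | one_tailed E x && [forall v, `[< P v #|x v|%:Z >]]]|.
Proof.
move=> hE; rewrite /num_orientations.
have inj := out_stars_inj hE.
rewrite -(@card_in_imset _ _ (@out_stars V E)); last first.
  by move=> o o'; rewrite !inE => /andP[ho _] /andP[ho' _]; apply: inj.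
have degP o : [forall v, `[< P v #|out_stars o v|%:Z >]] =
              [forall v : V, `[< P v (outdegree o v)%:Z >]].
  by apply: eq_forallb => v /=; rewrite card_out_stars.
apply: eq_card => x; rewrite !inE.
have /setP/(_ x) := out_stars_onto hE; rewrite inE => <-.
apply/imsetP/andP.
  move=> [o]; rewrite inE => /andP[ho hP] ->; split; last by rewrite degP.
  by apply: imset_f; rewrite inE.
case=> /imsetP[o]; rewrite inE => ho -> hP.
by exists o => //; rewrite inE ho -degP.
Qed.

(** Expansion of the product over e in E of (1 - (-1)^#|tails x e|) / 2.  In the
    term of F, counting the pairs (v, e) with e in F and e in x v by vertices
    instead of by edges turns the product of edge signs into a product of
    vertex signs. *)
Lemma prod_odd_indicator (V : finType) (E : {set {set V}})
    (x : {ffun V -> {set {set V}}}) :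
  [forall e in E, odd #|tails x e|]%:R =
  \sum_(F : {set {set V}} | F \subset E)
    (-1) ^+ #|F| / 2%:R ^+ #|E| * \prod_v (-1) ^+ #|F :&: x v| :> rat.
Proof.
transitivity
    (\prod_(e in E) ((1 + - (-1) ^+ #|tails x e|) / 2%:R) : rat).
  have ind e : (1 + - (-1) ^+ #|tails x e|) / 2%:R = (odd #|tails x e|)%:R :> rat.
    by rewrite -signr_odd; case: (odd _).
  rewrite (eq_bigr _ (fun e _ => ind e)) -natr_prod; congr (_%:R).
  case: forall_inP => [odd_x | /forall_inP].
    by rewrite big1 // => e /odd_x->.
  by case/forall_inPn => e eE /negPf odd_e; rewrite (bigD1 e) //= odd_e.
rewrite big_split /= prodr_const exprVn prodr_1D mulr_suml.
apply: eq_bigr => F _; rewrite prodrN mulrAC; congr (_ * _).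
rewrite !prodrXr; congr (_ ^+ _).
under eq_bigr => e _ do rewrite -sum1dep_card big_mkcond.
(* Double counting of the pairs (v, e) with e in F and e in x v. *)
rewrite exchange_big; apply: eq_bigr => v _.
rewrite -big_mkcondr -sum1_card.
by apply: eq_bigl => e; rewrite inE.
Qed.

Theorem theorem2p3 (V : finType) (E : {set {set V}}) (hE : simple_graph E)
    (P : V -> set int) :
  (num_orientations E P)%:R =
  \sum_(F : {set {set V}} | F \subset E)
    ((-1) ^+ #|F| / 2%:R ^+ #|E| *
     \prod_(v : V)
       coefs_in ((1 - 'X) ^+ degree F v *
                 (1 + 'X) ^+ (degree E v - degree F v)%N) (P v)) :> rat.
Proof.
pose sub_stars :=
  family (fun v => [pred S : {set {set V}} | S \subset star E v]).
transitivity (\sum_(x in sub_stars)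
    (\prod_v (`[< P v #|x v|%:Z >]%:R : rat)) *
    [forall e in E, odd #|tails x e|]%:R).
  rewrite num_orientations_one_tailed // -sum1dep_card natr_sum big_mkcond.
  rewrite [RHS]big_mkcond; apply: eq_bigr => x _; rewrite /one_tailed -/sub_stars.
  case: (x \in sub_stars) => //=; rewrite -natr_prod.
  case: [forall e in E, _]; rewrite ?mulr1 ?mulr0 //=.
  case: forallP => [allP | /forallP/forallPn[v /negPf nP]].
    by rewrite big1 // => v _; rewrite allP.
  by rewrite (bigD1 v) //= nP.
under eq_bigr => x _ do rewrite prod_odd_indicator mulr_sumr.
rewrite exchange_big; apply: eq_bigr => F sFE /=.
have sub_star v : star F v \subset star E v.
  by apply/fintype.subsetP => e; rewrite !inE => /andP[/(fintype.subsetP sFE)-> ->].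
under [in RHS]eq_bigr => v _ do rewrite (coefs_inE _ _ (sub_star v)).
(* Distributing the product over v turns a choice of one subset of star E v
   for each v into a single function x. *)
rewrite bigA_distr_big_dep mulr_sumr; apply: eq_bigr => x /familyP sub_x.
rewrite mulrCA -big_split; congr (_ * _); apply: eq_bigr => v _ /=.
(* The sets F and star F v have the same trace on x v, since x v only contains
   edges at v. *)
congr (_ * _ ^+ #|pred_of_set _|); apply/setP => e; rewrite !inE.
have := sub_x v; rewrite inE => /fintype.subsetP/(_ e).
rewrite inE; case: (e \in x v); last by rewrite !andbF.
by move=> /(_ isT)/andP[_ ->]; rewrite !andbT.
Qed.
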